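(* For the approximation problem $\mathrm{APP}=\{\mathrm{APP}_s\}_{s\in\mathbb N}$: (1) $\mathrm{APP}$ is EC-WT if and only if $m_0=1$ and $\lim_{j\to\infty}a_j=\infty$; (2) $\mathrm{APP}$ is EC-UWT if and only if $m_0=1$ and $\lim_{j\to\infty}\frac{\log a_j}{\log j}=\infty$.
   Context: Notation: $\mathbb N=\{1,2,\dots\}$, $\mathbb N_0=\{0,1,2,\dots\}$. Setting. $H$ is an infinite-dimensional separable Hilbert space over $\mathbb R$ or $\mathbb C$ with orthonormal basis $\{e_k\}_{k\in\mathbb N_0}$; $\omega\in(0,1)$; $\boldsymbol m=\{m_k\}_{k\in\mathbb N_0}$ is a bounded sequence of positive integers; $r_0=0$ and $r_k=m_0+\cdots+m_{k-1}$ for $k\ge1$. For $n\in\mathbb N_0$ let $k(n)$ be the unique $k\in\mathbb N_0$ with $r_k\le n\le r_{k+1}-1$. For $a,b>0$ let $$H_{a,b}=\Big\{f\in H:\ \|f\|_{H_{a,b}}:=\Big(\sum_{k=0}^\infty\omega^{-ak^b}\sum_{j=r_k}^{r_{k+1}-1}|\langle f,e_j\rangle_H|^2\Big)^{1/2}<\infty\Big\}.$$ The sequences $\boldsymbol a=\{a_j\}_{j\in\mathbb N}$, $\boldsymbol b=\{b_j\}_{j\in\mathbb N}$ consist of positive reals with $0<a_1\le a_2\le\cdots$ and $\inf_jb_j>0$. Let $H_s=H\otimes\cdots\otimes H$ ($s$-fold Hilbert tensor product) with orthonormal basis $e_{\boldsymbol n}=e_{n_1}\otimes\cdots\otimes e_{n_s}$,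 $\boldsymbol n\in\mathbb N_0^s$, and $H_{s,\boldsymbol a,\boldsymbol b}=H_{a_1,b_1}\otimes\cdots\otimes H_{a_s,b_s}$; equivalently, $H_{s,\boldsymbol a,\boldsymbol b}$ is the set of $f\in H_s$ with $\|f\|_{H_{s,\boldsymbol a,\boldsymbol b}}^2=\sum_{\boldsymbol n\in\mathbb N_0^s}\omega^{-\sum_{j=1}^sa_j[k(n_j)]^{b_j}}|\langle f,e_{\boldsymbol n}\rangle_{H_s}|^2<\infty$. The operator $\mathrm{APP}_s:H_{s,\boldsymbol a,\boldsymbol b}\to H_s$ is the embedding $\mathrm{APP}_sf=f$. Information complexity. For $n\in\mathbb N_0$, $e(n,\mathrm{APP}_s)=\inf_{A_n}\sup_{\|f\|_{H_{s,\boldsymbol a,\boldsymbol b}}\le1}\|f-A_nf\|_{H_s}$, the infimum being over all algorithms $A_nf=\sum_{j=1}^nL_j(f)g_j$ with continuous linear functionals $L_j$ on $H_{s,\boldsymbol a,\boldsymbol b}$ and $g_j\in H_s$ ($A_0=0$). For $\varepsilon>0$, $n(\varepsilon,\mathrm{APP}_s)=\min\{n\in\mathbb N_0:\ e(n,\mathrm{APP}_s)\le\varepsilon\}$. For $t_1,t_2>0$, EC-$(t_1,t_2)$-WT means $$\lim_{s+\varepsilon^{-1}\to\infty}\frac{\log n(\varepsilon,\mathrm{APP}_s)}{s^{t_1}+[\log\varepsilon^{-1}]^{t_2}}=0,$$ the limit being over $s\in\mathbb N$, $\varepsilon\in(0,1)$. EC-WT means EC-$(1,1)$-WT. EC-UWT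 means that EC-$(t_1,t_2)$-WT holds for all $t_1,t_2\in(0,1]$. *)

(* Defs.v *)
From HB Require Import structures.
From mathcomp Require Import all_boot all_order all_algebra.
From mathcomp Require Import complex.
From mathcomp Require Import all_classical all_reals all_analysis.

Set Implicit Arguments.
Unset Strict Implicit.
Unset Printing Implicit Defensive.

Import Order.TTheory GRing.Theory Num.Theory.
Import numFieldNormedType.Exports.
Local Open Scope classical_set_scope.
Local Open Scope ring_scope.

(* The scalar field is R or R[i]; norms and moduli live in the scalar field
   (following normedModType) and are real, so that [scal_Re] turns them into
   elements of R without loss. *)
Variant scalar_kind := RealScalars | ComplexScalars.

Definition scalars (R : realType) (k : scalar_kind) : numFieldType :=
  match k with
  | RealScalars => R : numFieldType
  | ComplexScalars => R[i] : numFieldType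
  end.

Definition scal_conj (R : realType) (k : scalar_kind) :
    {rmorphism scalars R k -> scalars R k} :=
  match k return {rmorphism scalars R k -> scalars R k} with
  | RealScalars => idfun
  | ComplexScalars => (Num.conj : {rmorphism R[i] -> R[i]})
  end.

Definition scal_Re (R : realType) (k : scalar_kind) : scalars R k -> R :=
  match k return scalars R k -> R with
  | RealScalars => fun x => x
  | ComplexScalars => fun x => complex.Re x
  end.

Definition scal_abs (R : realType) (k : scalar_kind) (z : scalars R k) : R :=
  scal_Re `|z|.

(* The inner product is linear in its first argument. *)
Record hilbertSpace (R : realType) (k : scalar_kind) := HilbertSpace {
  hilbert_sort :> completeNormedModType (scalars R k);
  hdot : {dot hilbert_sort for @scal_conj R k};
  hdot_norm : forall x : hilbert_sort, `|x| ^+ 2 = hdot x x }.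

Arguments hdot {R k} h.

Definition hnorm (R : realType) (k : scalar_kind) (H : hilbertSpace R k)
  (x : H) : R := scal_Re `|x|.

(* Having an orthonormal basis indexed by nat makes H separable and
   infinite-dimensional. *)
Definition orthonormal_basis (R : realType) (k : scalar_kind)
    (H : hilbertSpace R k) (e : nat -> H) : Prop :=
  (forall i j, hdot H (e i) (e j) = (i == j)%:R) /\
  (forall f : H, series (fun j => hdot H f (e j) *: e j) @ \oo --> f).

(* The s-fold Hilbert tensor power, characterized up to unitary isomorphism:
   [tens v] is the elementary tensor of v_0, ..., v_(s-1). *)
Record hilbertTensorPower (R : realType) (k : scalar_kind)
    (H : hilbertSpace R k) (s : nat) := HilbertTensorPower {
  tens_space :> hilbertSpace R k;
  tens : ('I_s -> H) -> tens_space;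
  tens_linear : forall (v : 'I_s -> H) (i : 'I_s) (c : scalars R k) (x y : H),
    tens (dfwith v i (c *: x + y)) =
    c *: tens (dfwith v i x) + tens (dfwith v i y);
  tens_dot : forall u v : 'I_s -> H,
    hdot tens_space (tens u) (tens v) = \prod_(i < s) hdot H (u i) (v i);
  tens_dense : closure [set x : tens_space |
      exists (n : nat) (c : 'I_n -> scalars R k) (v : 'I_n -> 'I_s -> H),
        x = \sum_(i < n) c i *: tens (v i)] = setT }.

Arguments tens {R k H s} h v.

Definition block_start (m : nat -> nat) (k : nat) : nat := (\sum_(i < k) m i)%N.

Definition block_index (m : nat -> nat) (n : nat) : nat :=
  xget 0%N [set k | (block_start m k <= n < block_start m k.+1)%N].

Section Approximation.
Variables (R : realType) (k : scalar_kind) (H : hilbertSpace R k).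
Variables (e : nat -> H) (omega : R) (m : nat -> nat) (a b : nat -> R).
Variables (s : nat) (Hs : hilbertTensorPower H s).

Definition tens_basis (n : {ffun 'I_s -> nat}) : Hs :=
  tens Hs (fun i => e (n i)).

(* [a] and [b] are indexed from 1, their value at 0 being irrelevant;
   the ordinal j < s stands for the coordinate j.+1. *)
Definition weight_exponent (n : {ffun 'I_s -> nat}) : R :=
  \sum_(j < s) a j.+1 * (block_index m (n j))%:R `^ b j.+1.

Definition wnorm (f : Hs) : \bar R :=
  poweR (\esum_(n in [set: {ffun 'I_s -> nat}])
    (omega `^ (- weight_exponent n) *
     scal_abs (hdot Hs f (tens_basis n)) ^+ 2)%:E) 2^-1.

Definition Hsab : set Hs := [set f | (wnorm f < +oo)%E].

(* Functionals on Hsab are represented by functions on the ambient space; only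
   their values on Hsab matter. Continuity is with respect to [wnorm]. *)
Definition continuous_functional (L : Hs -> scalars R k) : Prop :=
  (forall (c : scalars R k) (f g : Hs), Hsab f -> Hsab g ->
     L (c *: f + g) = c * L f + L g) /\
  (forall f : Hs, Hsab f -> forall eta : R, 0 < eta ->
     exists2 delta : R, 0 < delta &
       forall g : Hs, Hsab g -> (wnorm (g - f)%R < delta%:E)%E ->
         scal_abs (L g - L f) < eta).

Definition algorithm (n : nat) (A : Hs -> Hs) : Prop :=
  exists (L : 'I_n -> Hs -> scalars R k) (g : 'I_n -> Hs),
    (forall j, continuous_functional (L j)) /\
    (forall f, A f = \sum_(j < n) L j f *: g j).

Definition worst_case_error (A : Hs -> Hs) : \bar R :=
  ereal_sup [set (hnorm (f - A f))%:E | f in [set f | (wnorm f <= 1%:E)%E]].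

Definition minimal_error (n : nat) : \bar R :=
  ereal_inf [set worst_case_error A | A in algorithm n].

(* The minimum is attained, the minimal errors tending to 0 when the m_k are
   bounded, so that the default value 0 plays no role. *)
Definition info_complexity (eps : R) : nat :=
  xget 0%N [set n | (minimal_error n <= eps%:E)%E /\
    forall p : nat, (minimal_error p <= eps%:E)%E -> (n <= p)%N].

End Approximation.

Section Tractability.
Variables (R : realType) (N : nat -> R -> nat).

Definition EC_ttWT (t1 t2 : R) : Prop :=
  forall delta : R, 0 < delta -> exists M : R,
    forall (s : nat) (eps : R), (0 < s)%N -> 0 < eps < 1 ->
      M < s%:R + eps^-1 ->
      `|ln (N s eps)%:R / (s%:R `^ t1 + (ln eps^-1) `^ t2)| < delta.

Definition EC_WT : Prop := EC_ttWT 1 1.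

Definition EC_UWT : Prop :=
  forall t1 t2 : R, 0 < t1 <= 1 -> 0 < t2 <= 1 -> EC_ttWT t1 t2.

End Tractability.

(* Main.v *)
(** APP_s is diagonal in the tensor basis with singular values
    [omega^(W n / 2)], where [W n = sum_j a_j k(n_j)^(b_j)], so
    [n(eps, APP_s)] counts the [n] with [W n < T], [T = 2 ln(1/eps) / ln(1/omega)].
    If [m_0 >= 2] or [s a_s < T], the count is at least [2^s], as every
    [n] in [{0,1}^s] qualifies; choosing [T] of order [s a_s] gives necessity.
    If [m_0 = 1], Chernoff's bound gives, for every [x > 0],
    [ln n(eps, APP_s) <= x T + sum_(j <= s) ln (1 + C / (x a_j)^q)]
    with [C] and [q] independent of [s] and [eps]. A small constant [x]
    proves sufficiency in (1). For (2) take [x] of order [1/T]: since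
    [ln (1 + v^p) <= p v], the sum is at most a constant times
    [T^theta sum_j a_j^(-theta)] with [theta = q/p] as small as we like, and
    the series converges because [a_j] outgrows every power of [j]. *)

Require Import Defs.
From HB Require Import structures.
From mathcomp Require Import all_boot all_order all_algebra.
From mathcomp Require Import complex.
From mathcomp Require Import all_classical all_reals all_analysis.
From mathcomp Require Import ring lra.

Set Implicit Arguments.
Unset Strict Implicit.
Unset Printing Implicit Defensive.

Import Order.TTheory GRing.Theory Num.Theory.
Import numFieldNormedType.Exports.
Local Open Scope classical_set_scope.
Local Open Scope ring_scope.

(** * Hilbert spaces over the two scalar fields *)

Section ScalarTheory.
Variables (R : realType) (k : scalar_kind).
Implicit Types (x : R) (z : scalars R k).

(** Identities for real moduli are proved by applying this injection, which turns [scal_abs z] into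
    the norm of the scalar field. *)
Definition scal_real : R -> scalars R k :=
  match k return R -> scalars R k with
  | RealScalars => fun x => x
  | ComplexScalars => fun x => (x%:C)%C
  end.

Lemma scal_ReD : {morph @scal_Re R k : z1 z2 / z1 + z2}.
Proof. by rewrite /scal_Re; case: k => //= -[a b] [c d]. Qed.

Lemma scal_Re_real x : scal_Re (scal_real x) = x.
Proof. by rewrite /scal_Re /scal_real; case: k. Qed.

Lemma scal_real_Re z : 0 <= z -> scal_real (scal_Re z) = z.
Proof.
rewrite /scal_Re /scal_real; case: k z => //= -[a b].
by rewrite lecE /= => /andP[/eqP -> _].
Qed.

Lemma scal_Re_le z1 z2 : z1 <= z2 -> scal_Re z1 <= scal_Re z2.
Proof.
rewrite /scal_Re; case: k z1 z2 => //= -[a b] [c d].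
by rewrite lecE /= => /andP[].
Qed.

Lemma scal_real_lt : {mono scal_real : x y / x < y}.
Proof. by rewrite /scal_real; case: k => //= x y; rewrite ltcR. Qed.

Lemma scal_realM : {morph scal_real : x y / x * y}.
Proof. by rewrite /scal_real; case: k => //= x y; rewrite rmorphM. Qed.

Lemma scal_real0 : scal_real 0 = 0.
Proof. by rewrite /scal_real; case: k. Qed.

Lemma scal_Re0 : scal_Re (0 : scalars R k) = 0.
Proof. by rewrite /scal_Re; case: k. Qed.

Lemma scal_Re_sum I (r : seq I) (P : pred I) (F : I -> scalars R k) :
  scal_Re (\sum_(i <- r | P i) F i) = \sum_(i <- r | P i) scal_Re (F i).
Proof. exact: (big_morph _ scal_ReD scal_Re0). Qed.

Lemma scal_real_abs z : scal_real (scal_abs z) = `|z|.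
Proof. by rewrite scal_real_Re. Qed.

Lemma scal_abs_ge0 z : 0 <= scal_abs z.
Proof. by rewrite -scal_Re0; exact: scal_Re_le. Qed.

Lemma scal_abs0 : scal_abs (0 : scalars R k) = 0.
Proof. by rewrite /scal_abs normr0 scal_Re0. Qed.

Lemma scal_real_inj : injective scal_real.
Proof. exact: (can_inj scal_Re_real). Qed.

Lemma scal_abs_eq0 z : (scal_abs z == 0) = (z == 0).
Proof. by rewrite -(inj_eq scal_real_inj) scal_real_abs scal_real0 normr_eq0. Qed.

Lemma scal_absM : {morph @scal_abs R k : z1 z2 / z1 * z2}.
Proof.
by move=> z1 z2; apply: scal_real_inj; rewrite scal_realM !scal_real_abs normrM.
Qed.

Lemma scal_abs_real x : 0 <= x -> scal_abs (scal_real x) = x.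
Proof.
move=> x0; apply: scal_real_inj; rewrite scal_real_abs ger0_norm //.
move: x0; rewrite le_eqVlt => /predU1P[<-|x0]; first by rewrite scal_real0.
by rewrite ltW // -scal_real0 scal_real_lt.
Qed.

Lemma mul_scal_conj z : z * @scal_conj R k z = `|z| ^+ 2.
Proof.
rewrite /scal_conj; case: k z => /= z;
  first by rewrite real_normK ?num_real // expr2.
by rewrite normCK.
Qed.

Lemma scal_absX2 z : scal_Re (`|z| ^+ 2) = scal_abs z ^+ 2.
Proof. by rewrite -scal_real_abs expr2 -scal_realM scal_Re_real. Qed.

End ScalarTheory.

Section HilbertTheory.
Variables (R : realType) (k : scalar_kind) (H : hilbertSpace R k).
Implicit Types (x y f g : H).

Lemma hdotDl x y f : hdot H (x + y) f = hdot H x f + hdot H y f.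
Proof. exact: linearDl. Qed.
Lemma hdotBl x y f : hdot H (x - y) f = hdot H x f - hdot H y f.
Proof. exact: linearBl. Qed.
Lemma hdotZl c x f : hdot H (c *: x) f = c * hdot H x f.
Proof. exact: linearZl_LR. Qed.
Lemma hdotDr x y f : hdot H f (x + y) = hdot H f x + hdot H f y.
Proof. exact: linearDr. Qed.
Lemma hdotZr c x f : hdot H f (c *: x) = @scal_conj R k c * hdot H f x.
Proof. exact: linearZr_LR. Qed.
Lemma hdot_suml I (r : seq I) (F : I -> H) f :
  hdot H (\sum_(i <- r) F i) f = \sum_(i <- r) hdot H (F i) f.
Proof. exact: linear_sumlz. Qed.
Lemma hdot_sumr I (r : seq I) (F : I -> H) f :
  hdot H f (\sum_(i <- r) F i) = \sum_(i <- r) hdot H f (F i).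
Proof. exact: linear_sumr. Qed.

Lemma hdotC x y : hdot H x y = @scal_conj R k (hdot H y x).
Proof. by rewrite hermC expr0 mul1r. Qed.

Lemma hnorm_ge0 x : 0 <= hnorm x.
Proof. by rewrite -(scal_Re0 _ k); exact: scal_Re_le. Qed.

Lemma scal_real_hnorm x : scal_real k (hnorm x) = `|x|.
Proof. by rewrite scal_real_Re. Qed.

Lemma hnormX2 x : hnorm x ^+ 2 = scal_Re (hdot H x x).
Proof.
by rewrite -hdot_norm -scal_real_hnorm [in RHS]expr2 -scal_realM scal_Re_real.
Qed.

Lemma hnormD x y : hnorm (x + y) <= hnorm x + hnorm y.
Proof. by rewrite /hnorm -scal_ReD; apply: scal_Re_le; exact: ler_normD. Qed.

Lemma hnorm_pythagoras x y : hdot H x y = 0 ->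
  hnorm (x + y) ^+ 2 = hnorm x ^+ 2 + hnorm y ^+ 2.
Proof.
move=> xy; rewrite !hnormX2 hdotDl !hdotDr xy (hdotC y x) xy rmorph0 addr0 add0r.
by rewrite scal_ReD.
Qed.

End HilbertTheory.

(** * Orthonormal families *)

Section OrthonormalFamily.
Variables (R : realType) (k : scalar_kind) (H : hilbertSpace R k).
Variables (I : eqType) (E : I -> H).
Implicit Types (f g h : H) (S : seq I).

(** With lists of coefficient-index pairs, repetitions allowed, sums of combinations are
    concatenations. *)
Definition lin_comb h : Prop :=
  exists s : seq (scalars R k * I), h = \sum_(p <- s) p.1 *: E p.2.

(** This is membership in the closed linear span of [E]; the tolerance is a scalar because norms
    are. *)
Definition approximable f : Prop := forall eta : scalars R k, 0 < eta ->
  exists2 h, lin_comb h & `|f - h| < eta.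

Lemma approximable_basis i : approximable (E i).
Proof.
move=> eta eta0; exists (E i); last by rewrite subrr normr0.
by exists [:: (1, i)]; rewrite big_seq1 scale1r.
Qed.

Lemma approximable0 : approximable 0.
Proof.
move=> eta eta0; exists 0; last by rewrite subrr normr0.
by exists [::]; rewrite big_nil.
Qed.

Lemma approximable_lin c f g :
  approximable f -> approximable g -> approximable (c *: f + g).
Proof.
move=> hf hg eta eta0.
have c0 : 0 < `|c| + 1 by rewrite ltr_wpDl.
have eta1 : 0 < eta / 2 / (`|c| + 1) by rewrite !divr_gt0.
have eta2 : 0 < eta / 2 by rewrite divr_gt0.
have [_ [s1 ->] h1] := hf _ eta1; have [_ [s2 ->] h2] := hg _ eta2.
exists (c *: (\sum_(p <- s1) p.1 *: E p.2) + \sum_(p <- s2) p.1 *: E p.2).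
  exists ([seq (c * p.1, p.2) | p <- s1] ++ s2).
  rewrite big_cat big_map /= scaler_sumr; congr (_ + _).
  by apply: eq_bigr => p _; rewrite scalerA.
rewrite opprD addrACA -scalerBr [ltRHS]splitr.
apply: le_lt_trans (ler_normD _ _) _; apply: ler_ltD => //.
rewrite normrZ; apply: (@le_trans _ _ ((`|c| + 1) * (eta / 2 / (`|c| + 1)))).
  by apply: ler_pM => //; [rewrite lerDl | exact: ltW].
by rewrite mulrC divfK // gt_eqF.
Qed.

Lemma approximable_sum J (s : seq J) (c : J -> scalars R k) (f : J -> H) :
  (forall j, approximable (f j)) -> approximable (\sum_(j <- s) c j *: f j).
Proof.
move=> hf; elim: s => [|j s IH]; first by rewrite big_nil; exact: approximable0.
by rewrite big_cons; apply: approximable_lin.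
Qed.

Lemma approximable_lim f : (forall eta : scalars R k, 0 < eta ->
  exists2 g, approximable g & `|f - g| < eta) -> approximable f.
Proof.
move=> hf eta eta0; have eta2 : 0 < eta / 2 by rewrite divr_gt0.
have [g hg fg] := hf _ eta2; have [h hh gh] := hg _ eta2.
exists h => //; rewrite -(subrKA g) [ltRHS]splitr.
by apply: le_lt_trans (ler_normD _ _) _; exact: ltrD.
Qed.

Hypothesis orthoE : forall i j, hdot H (E i) (E j) = (i == j)%:R.

Definition orth_proj S f : H := \sum_(i <- S) hdot H f (E i) *: E i.

Lemma hdot_sum_basis S (c : I -> scalars R k) j : uniq S ->
  hdot H (\sum_(i <- S) c i *: E i) (E j) = if j \in S then c j else 0.
Proof.
move=> uS; rewrite hdot_suml.
under eq_bigr => i _ do rewrite hdotZl orthoE.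
case: ifP => jS.
  rewrite (bigD1_seq j) //= eqxx mulr1 big1 ?addr0 // => i /negPf ->.
  by rewrite mulr0.
rewrite big_seq big1 // => i iS.
by case: eqP => [ij|_]; [rewrite -ij iS in jS | rewrite mulr0].
Qed.

Lemma hnorm_sum_basis S (c : I -> scalars R k) : uniq S ->
  hnorm (\sum_(i <- S) c i *: E i) ^+ 2 = \sum_(i <- S) scal_abs (c i) ^+ 2.
Proof.
move=> uS; rewrite hnormX2 hdot_sumr scal_Re_sum big_seq [RHS]big_seq.
apply: eq_bigr => j jS.
by rewrite hdotZr hdot_sum_basis // jS mulrC mul_scal_conj scal_absX2.
Qed.

Lemma hdot_sub_orth_proj S f j : uniq S -> j \in S ->
  hdot H (f - orth_proj S f) (E j) = 0.
Proof. by move=> uS jS; rewrite hdotBl hdot_sum_basis // jS subrr. Qed.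

Lemma orth_projB S f g : orth_proj S (f - g) = orth_proj S f - orth_proj S g.
Proof.
rewrite -sumrB; apply: eq_bigr => i _; by rewrite hdotBl scalerBl.
Qed.

(** The hypothesis on [h] puts it in the span of [S]. Then [f - h] splits into [f - orth_proj S f],
    orthogonal to that span, and [orth_proj S (f - h)], which lies in it, so Pythagoras applies. *)
Lemma hnorm_sub_orth_proj S f h : uniq S -> orth_proj S h = h ->
  hnorm (f - orth_proj S f) <= hnorm (f - h).
Proof.
move=> uS hS; rewrite -(@ler_pXn2r _ 2) ?nnegrE ?hnorm_ge0 //.
rewrite -(subrKA (orth_proj S f) f (- h)). rewrite -hS -orth_projB.
rewrite [leRHS]hnorm_pythagoras ?lerDl ?sqr_ge0 // {2}/orth_proj.
rewrite hdot_sumr big_seq big1 // => i iS.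
by rewrite hdotZr hdot_sub_orth_proj // mulr0.
Qed.

Lemma orth_proj_lin_comb S (s : seq (scalars R k * I)) :
  uniq S -> {subset map snd s <= S} ->
  orth_proj S (\sum_(p <- s) p.1 *: E p.2) = \sum_(p <- s) p.1 *: E p.2.
Proof.
move=> uS sS; rewrite /orth_proj.
under eq_bigr => i _ do rewrite hdot_suml scaler_suml.
rewrite exchange_big /= big_seq [RHS]big_seq; apply: eq_bigr => p ps.
rewrite (bigD1_seq p.2) //=; last by apply: sS; apply: map_f.
rewrite hdotZl orthoE eqxx mulr1 big1 ?addr0 // => i ip.
by rewrite hdotZl orthoE eq_sym (negPf ip) mulr0 scale0r.
Qed.

(** A form of Parseval with finite sums only. A combination within [eta] of [f] involves finitely
    many indices; projecting on these together with [S] misses [f] by at most [eta], and the part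
    outside [S] has norm at most [eps]. *)
Lemma hnorm_tail S f (eps : R) : approximable f -> uniq S -> 0 <= eps ->
  (forall S', uniq S' -> {in S', forall i, i \notin S} ->
    \sum_(i <- S') scal_abs (hdot H f (E i)) ^+ 2 <= eps ^+ 2) ->
  hnorm (f - orth_proj S f) <= eps.
Proof.
move=> fE uS eps0 tail; apply/ler_addgt0Pl => eta eta0.
have eta0' : 0 < scal_real k eta by rewrite -(scal_real0 _ k) scal_real_lt.
have [_ [s ->]] := fE _ eta0'.
rewrite -scal_real_hnorm scal_real_lt => /ltW fs.
set S' := [seq i <- undup (map snd s) | i \notin S].
have uS' : uniq S' by rewrite filter_uniq // undup_uniq.
have S'S : {in S', forall i, i \notin S}.
  by move=> i; rewrite mem_filter => /andP[].
have uU : uniq (S ++ S').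
  rewrite cat_uniq uS uS' andbT /=; apply/hasPn => i; exact: S'S.
have sU : {subset map snd s <= S ++ S'}.
  by move=> i si; rewrite mem_cat mem_filter mem_undup si andbT orbN.
rewrite -(subrKA (orth_proj (S ++ S') f)); apply: le_trans (hnormD _ _) _.
apply: lerD.
  by apply: le_trans fs; apply: hnorm_sub_orth_proj => //;
    rewrite orth_proj_lin_comb.
rewrite /orth_proj big_cat /= addrAC subrr add0r.
rewrite -(@ler_pXn2r _ 2) ?nnegrE ?hnorm_ge0 //.
by rewrite hnorm_sum_basis //; exact: tail.
Qed.

End OrthonormalFamily.

(** * The tensor basis is total *)

Section TensorBasis.
Variables (R : realType) (k : scalar_kind) (H : hilbertSpace R k).
Variables (e : nat -> H) (s : nat) (Hs : hilbertTensorPower H s).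
Hypothesis he : orthonormal_basis e.
Implicit Types (v : 'I_s -> H) (x y : H).

Lemma tens_basis_orthonormal (n n' : {ffun 'I_s -> nat}) :
  hdot Hs (tens_basis e Hs n) (tens_basis e Hs n') = (n == n')%:R.
Proof.
rewrite tens_dot; under eq_bigr => i _ do rewrite (proj1 he).
case: eqP => [->|nn']; first by rewrite big1 // => i _; rewrite eqxx.
have [i /negPf ni] : exists i, n i != n' i.
  apply/existsP; apply: contra_notT nn'; rewrite negb_exists => /forallP h.
  by apply/ffunP => i; apply/eqP; rewrite -[_ == _]negbK.
by rewrite (bigD1 i) //= ni mul0r.
Qed.

Lemma tens_norm v : `|tens Hs v| = \prod_(i < s) `|v i|.
Proof.
apply/eqP; rewrite -(@eqrXn2 _ 2) ?prodr_ge0 // -prodrXl hdot_norm tens_dot.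
by apply/eqP; apply: eq_bigr => i _; rewrite -hdot_norm.
Qed.

Lemma tens0 v i : tens Hs (dfwith v i 0) = 0.
Proof.
by have := tens_linear Hs v i (-1) 0 0; rewrite scaler0 addr0 scaleN1r addNr.
Qed.

Lemma tens_sub v i x y :
  tens Hs (dfwith v i x) - tens Hs (dfwith v i y) = tens Hs (dfwith v i (x - y)).
Proof. by rewrite [x - y]addrC -(scaleN1r y) tens_linear scaleN1r addrC. Qed.

Lemma tens_sum v i (J : Type) (r : seq J) (c : J -> scalars R k) (x : J -> H) :
  tens Hs (dfwith v i (\sum_(j <- r) c j *: x j)) =
  \sum_(j <- r) c j *: tens Hs (dfwith v i (x j)).
Proof.
elim: r => [|j r IH]; first by rewrite !big_nil tens0.
by rewrite !big_cons tens_linear IH.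
Qed.

(* The coordinates of an elementary tensor are released from the basis one at a
   time; by linearity and continuity in each of them the tensor stays in the
   closed span. *)
Lemma tens_approximable_partial (p : nat) v : (p <= s)%N ->
  (forall i : 'I_s, (p <= i)%N -> exists n, v i = e n) ->
  approximable (tens_basis e Hs) (tens Hs v).
Proof.
elim: p v => [|p IH] v ps hv.
  have /boolp.choice[n hn] : forall i, exists n, v i = e n by move=> i; exact: hv.
  have -> : tens Hs v = tens_basis e Hs [ffun i => n i].
    by congr tens; apply/funext => i; rewrite ffunE hn.
  exact: approximable_basis.
pose i := Ordinal ps; have vi : v = dfwith v i (v i).
  apply/funext => j; have [->|ij] := eqVneq j i; first by rewrite dfwithin.
  by rewrite dfwithout // eq_sym.
apply: approximable_lim => eta eta0.
set C := \prod_(j < s | j != i) `|v j|.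
(* Adding 1 keeps the divisor positive when some [v j] is zero. *)
have C0 : 0 < C + 1 by rewrite ltr_wpDl // prodr_ge0.
have := proj2 he (v i) => /cvgrPdist_lt /(_ (eta / (C + 1))).
rewrite divr_gt0 // => /(_ isT) [N _ /(_ N (leqnn N))] /=.
rewrite /series /= => hN.
exists (tens Hs (dfwith v i (\sum_(0 <= j < N) hdot H (v i) (e j) *: e j))).
  rewrite tens_sum; apply: approximable_sum => j.
  apply: IH => [|i' pi']; first exact: ltnW.
  have [->|ii'] := eqVneq i' i; first by exists j; rewrite dfwithin.
  rewrite dfwithout 1?eq_sym //; apply: hv.
  by rewrite ltn_neqAle pi' andbT eq_sym; exact: ii'.
rewrite {1}vi tens_sub tens_norm (bigD1 i) //= dfwithin.
rewrite (eq_bigr (fun j => `|v j|)) -/C => [|j ji]; last first.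
  by rewrite dfwithout // eq_sym.
apply: (@le_lt_trans _ _ (`|v i - \sum_(0 <= j < N) hdot H (v i) (e j) *: e j| *
  (C + 1))).
  by apply: ler_wpM2l => //; rewrite lerDl.
by rewrite -ltr_pdivlMr.
Qed.

Lemma tens_approximable v : approximable (tens_basis e Hs) (tens Hs v).
Proof.
by apply: (@tens_approximable_partial s) => // i; rewrite leqNgt ltn_ord.
Qed.

Lemma tens_basis_total (f : Hs) : approximable (tens_basis e Hs) f.
Proof.
apply: approximable_lim => eta eta0.
have : closure [set x : Hs | exists (n : nat) (c : 'I_n -> scalars R k)
    (v : 'I_n -> 'I_s -> H), x = \sum_(i < n) c i *: tens Hs (v i)] f.
  by rewrite tens_dense.
move=> /(_ _ (nbhsx_ballx f eta eta0)) [g [[n [c [v ->]]]]].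
rewrite -ball_normE /= => fg; eexists; last exact: fg.
by apply: approximable_sum => i; exact: tens_approximable.
Qed.

End TensorBasis.

(** * Minimal errors *)

Section MinimalError.
Variables (R : realType) (k : scalar_kind) (H : hilbertSpace R k).
Variables (e : nat -> H) (omega : R) (m : nat -> nat) (a b : nat -> R).
Variables (s : nat) (Hs : hilbertTensorPower H s).
Hypothesis he : orthonormal_basis e.
Hypothesis omega0 : 0 < omega.
Implicit Types (f g : Hs) (n : {ffun 'I_s -> nat}) (S : seq {ffun 'I_s -> nat}).

Let E := tens_basis e Hs.
Let wt n : R := omega `^ (- weight_exponent m a b n).
Let wn f := wnorm e omega m a b f.

Let wt_gt0 n : 0 < wt n. Proof. exact: powR_gt0. Qed.

Let orthoE := tens_basis_orthonormal Hs he.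

(** This reduces a bound on the extended-real norm to real inequalities for finite partial sums, the
    form in which such bounds are used below. *)
Lemma wnorm_le_sum f (d : R) S : 0 <= d -> (wn f <= d%:E)%E -> uniq S ->
  \sum_(n <- S) wt n * scal_abs (hdot Hs f (E n)) ^+ 2 <= d ^+ 2.
Proof.
move=> d0; rewrite /wn /wnorm.
set X := (\esum_(_ in _) _)%E => Xd uS.
have SX : ((\sum_(n <- S) wt n * scal_abs (hdot Hs f (E n)) ^+ 2)%:E <= X)%E.
  apply: esum_ge; exists [set` S]; first by split; [exact: finite_seq|].
  by rewrite -fsbig_seq // sumEFin.
apply: (@le_trans _ _ (fine X)).
  have : (X < +oo)%E.
    by apply: (lty_poweRy _ (le_lt_trans Xd (ltry d))); rewrite invr_eq0 pnatr_eq0.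
  by move: SX; case: X {Xd} => //= r; rewrite lee_fin.
move: Xd SX; case: X => [r||] //=; last by rewrite sqr_ge0.
rewrite !lee_fin => rd Sr.
have r0 : 0 <= r.
  by apply: le_trans Sr; apply: sumr_ge0 => n _; rewrite mulr_ge0 ?sqr_ge0 // ltW.
by move: rd; rewrite powR12_sqrt // -{2}(sqr_sqrtr r0) ler_pXn2r // nnegrE.
Qed.

Lemma wnorm_sum_basis S (c : {ffun 'I_s -> nat} -> scalars R k) : uniq S ->
  wn (\sum_(n <- S) c n *: E n) =
  ((\sum_(n <- S) wt n * scal_abs (c n) ^+ 2) `^ 2^-1)%:E.
Proof.
move=> uS; rewrite /wn /wnorm -poweR_EFin; congr poweR.
rewrite -sumEFin [RHS]fsbig_seq // -esum_fset //; last first.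
  by move=> n _; rewrite lee_fin mulr_ge0 ?sqr_ge0 // ltW.
rewrite [RHS]esum_mkcond; apply: eq_esum => n _.
rewrite (hdot_sum_basis orthoE) // mem_setE.
by case: ifP => //; rewrite scal_abs0 expr0n mulr0.
Qed.

Lemma Hsab_sum_basis S c : uniq S ->
  Hsab e omega m a b (\sum_(n <- S) c n *: E n).
Proof. by move=> uS; rewrite /Hsab /= -/(wn _) wnorm_sum_basis // ltry. Qed.

Lemma continuous_hdot n :
  continuous_functional e omega m a b (fun f : Hs => hdot Hs f (E n)).
Proof.
split=> [c f g _ _|f _ eta eta0]; first by rewrite hdotDl hdotZl.
have sq0 : 0 < Num.sqrt (wt n) by rewrite sqrtr_gt0.
have d0 : 0 < eta / 2 * Num.sqrt (wt n) by rewrite mulr_gt0 // divr_gt0.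
(* A coefficient is at most [wn f / sqrt (wt n)]; the factor 1/2 restores the strictness lost
   through [ltW]. *)
exists (eta / 2 * Num.sqrt (wt n)) => // g _ /ltW.
move=> /(wnorm_le_sum (S := [:: n]) (ltW d0)) /(_ isT).
rewrite big_seq1 exprMn sqr_sqrtr ?(ltW (wt_gt0 n)) // mulrC ler_pM2r //.
rewrite ler_pXn2r ?nnegrE ?scal_abs_ge0 ?divr_ge0 ?(ltW eta0) // -hdotBl.
by move=> /le_lt_trans; apply; rewrite ltr_pdivrMr // mulr_natr mulr2n ltrDl.
Qed.

(** The algorithm is the orthogonal projection on [S]. Outside [S] each squared coefficient is at
    most [eps ^+ 2] times its weighted version, and the weighted ones sum to at most 1 on the unit
    ball. *)
Lemma minimal_error_upper S (eps : R) : 0 < eps -> uniq S ->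
  (forall n, n \notin S -> eps ^- 2 <= wt n) ->
  (minimal_error e omega m a b Hs (size S) <= eps%:E)%E.
Proof.
move=> eps0 uS hS; apply: (@le_trans _ _ (worst_case_error e omega m a b
  (orth_proj E S))).
  apply: ereal_inf_lbound; exists (orth_proj E S) => //.
  exists (fun j f => hdot Hs f (E (tnth (in_tuple S) j))).
  exists (fun j => E (tnth (in_tuple S) j)); split=> [j|f];
    first exact: continuous_hdot.
  by rewrite /orth_proj [in LHS](big_tnth _ _ S).
apply: ge_ereal_sup => _ [f /= fle <-]; rewrite lee_fin.
apply: (hnorm_tail orthoE) => //; [exact: tens_basis_total|exact: ltW|].
move=> S' uS' S'S; have := wnorm_le_sum ler01 fle uS'.
rewrite expr1n => le1; rewrite -[leRHS]mulr1.
have e2 : 0 < eps ^+ 2 by rewrite exprn_gt0.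
rewrite mulrC -ler_pdivrMr //; apply: le_trans le1.
rewrite mulr_suml big_seq [leRHS]big_seq; apply: ler_sum => n nS'.
by rewrite mulrC; apply: ler_wpM2r; [exact: sqr_ge0|exact/hS/S'S].
Qed.

(** Supplies a bound [y] common to all algorithms, so that the infimum of their errors, and not only
    each error, exceeds [eps]. *)
Lemma seq_lt_gap (I : eqType) (r : seq I) (w : I -> R) (x : R) : 0 < x ->
  {in r, forall i, w i < x} -> exists y, [/\ 0 < y, y < x & {in r, forall i, w i
    <= y}].
Proof.
move=> x0; elim: r => [|i r IH] wx.
  by exists (x / 2); split;
    rewrite ?divr_gt0 // ltr_pdivrMr // mulr_natr mulr2n ltrDl.
have [|y [y0 yx wy]] := IH; first by move=> j jr; apply: wx; rewrite inE jr orbT.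
exists (Num.max (w i) y); split; first by rewrite lt_max y0 orbT.
  by rewrite gt_max yx wx // mem_head.
move=> j; rewrite inE le_max => /predU1P[->|/wy ->]; first by rewrite lexx.
by rewrite orbT.
Qed.

(** Linearity is granted on [Hsab] only, so the induction must place each basis vector and each
    partial sum there. *)
Lemma functional_sum (L : Hs -> scalars R k) S c :
  continuous_functional e omega m a b L -> uniq S ->
  L (\sum_(n <- S) c n *: E n) = \sum_(n <- S) c n * L (E n).
Proof.
move=> [Llin _].
have HE n : Hsab e omega m a b (E n).
  have := Hsab_sum_basis (S := [:: n]) (fun=> 1) isT.
  by rewrite big_seq1 scale1r.
elim: S => [|n S IH] /= => [_|/andP[nS uS]].
  rewrite !big_nil; have H0 : Hsab e omega m a b (0 : Hs).
    by have := Hsab_sum_basis (S := [::]) (fun=> 1) isT; rewrite big_nil.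
  have /eqP := Llin 1 _ _ H0 H0.
  by rewrite scaler0 addr0 mul1r -subr_eq0 opprD addrA subrr sub0r oppr_eq0 => /eqP.
by rewrite !big_cons Llin ?IH //; exact: Hsab_sum_basis.
Qed.

(* Fewer than [size S] functionals vanish simultaneously on a nonzero
   combination of the basis vectors in [S]. *)
Lemma minimal_error_lower S (eps : R) (p : nat) : 0 < eps -> uniq S ->
  {in S, forall n, wt n < eps ^- 2} ->
  (minimal_error e omega m a b Hs p <= eps%:E)%E -> (size S <= p)%N.
Proof.
move=> eps0 uS hS; rewrite leqNgt; apply: contraPN => pS; apply/negP.
have e2 : 0 < eps ^- 2 by rewrite invr_gt0 exprn_gt0.
have [y [y0 ye wy]] := seq_lt_gap e2 hS; rewrite -ltNge.
apply: (@lt_le_trans _ _ ((Num.sqrt y)^-1)%:E).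
  rewrite lte_fin -[ltLHS]invrK ltf_pV2 ?posrE ?invr_gt0 ?sqrtr_gt0 //.
  by rewrite -(@ltr_pXn2r _ 2) ?nnegrE ?invr_ge0 ?(ltW eps0) // exprVn sqr_sqrtr
    // ltW.
apply: le_ereal_inf_tmp => _ [A [L [g [hL hA]]] <-].
pose M := \matrix_(i < size S, j < p) L j (E (tnth (in_tuple S) i)).
have : (kermx M != 0).
  by rewrite -mxrank_eq0 mxrank_ker -lt0n subn_gt0 (leq_ltn_trans _ pS) //
    rank_leq_col.
case/rowV0Pn => u uM u0; have {}uM : u *m M = 0 by exact/sub_kermxP.
have n0P : exists n, n \in S.
  by case: (S) pS => // n S' _; exists n; rewrite mem_head.
have Sgt : (0 < size S)%N by exact: leq_ltn_trans pS.
(* The kernel vector is indexed by positions in [S]; [index] carries it to multi-indices, the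
   default of [insubd] being reached only outside [S]. *)
pose c n : scalars R k := u ord0 (insubd (Ordinal Sgt) (index n S)).
have cE i : c (tnth (in_tuple S) i) = u ord0 i.
  rewrite /c; congr (u _ _); apply: val_inj; rewrite val_insubd /=.
  have [n0 _] := n0P; rewrite (tnth_nth n0) /= index_uniq //.
  by rewrite ltn_ord.
pose Q := \sum_(n <- S) wt n * scal_abs (c n) ^+ 2.
have [i ui] : exists i, u ord0 i != 0.
  by have /rV0Pn := u0.
have Q0 : 0 < Q.
  rewrite /Q big_tnth (bigD1 i) //= ltr_wpDr //.
    by apply: sumr_ge0 => j _; rewrite mulr_ge0 ?sqr_ge0 // ltW.
  by rewrite mulr_gt0 // exprn_gt0 // lt_neqAle scal_abs_ge0 eq_sym scal_abs_eq0
    cE ui.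
(* Scaling by this factor gives [f] weighted norm 1. *)
pose t : scalars R k := scal_real k (Num.sqrt Q)^-1.
have st : scal_abs t = (Num.sqrt Q)^-1.
  by rewrite scal_abs_real // invr_ge0 sqrtr_ge0.
pose f := \sum_(n <- S) (t * c n) *: E n.
have Lf j : L j f = 0.
  rewrite functional_sum //.
  under eq_bigr => n _ do rewrite -mulrA.
  rewrite -mulr_sumr big_tnth /=.
  have /matrixP /(_ ord0 j) := uM; rewrite !mxE => uMj.
  by rewrite (eq_bigr (fun i => u ord0 i * M i j)) ?uMj ?mulr0 // => i' _;
    rewrite mxE cE.
have Af : A f = 0 by rewrite hA big1 // => j _; rewrite Lf scale0r.
have abs_tc n : scal_abs (t * c n) ^+ 2 = Q^-1 * scal_abs (c n) ^+ 2.
  by rewrite scal_absM st exprMn exprVn sqr_sqrtr // ltW.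
apply: (@le_trans _ _ (hnorm (f - A f))%:E); last first.
  apply: ereal_sup_ubound; exists f => //=.
  rewrite -/(wn f) wnorm_sum_basis // lee_fin.
  under eq_bigr => n _ do rewrite abs_tc mulrCA.
  by rewrite -mulr_sumr -/Q mulVf ?gt_eqF // powR1.
(* The squared error at [f] is the sum of the [|c n|^2] divided by [Q]; the weights in [S] being at
   most [y], it is at least [1 / y]. *)
rewrite lee_fin Af subr0 -(@ler_pXn2r _ 2) ?nnegrE ?invr_ge0 ?sqrtr_ge0 ?hnorm_ge0
  //.
rewrite exprVn sqr_sqrtr ?(ltW y0) // (hnorm_sum_basis orthoE) //.
under eq_bigr => n _ do rewrite abs_tc.
rewrite -mulr_sumr mulrC ler_pdivlMr // mulrC ler_pdivrMr // /Q mulr_suml.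
rewrite big_seq [leRHS]big_seq; apply: ler_sum => n nS.
by rewrite mulrC; apply: ler_wpM2l; [exact: sqr_ge0|exact: wy].
Qed.

(** The two bounds meet at [size S]. The threshold is strict because an error equal to [eps] is
    allowed, so indices of weight exactly [eps ^- 2] are left out of the projection. *)
Lemma info_complexityE S (eps : R) : 0 < eps -> uniq S ->
  (forall n, (n \in S) = (wt n < eps ^- 2)) ->
  info_complexity e omega m a b Hs eps = size S.
Proof.
move=> eps0 uS hS; rewrite /info_complexity;
  case: xgetP => [_ -> /= [me mp]|/(_ (size S))].
  apply/eqP; rewrite eqn_leq; apply/andP; split.
    by apply: mp; apply: minimal_error_upper => // n; rewrite hS -leNgt.
  by apply: minimal_error_lower me => // n; rewrite hS.
case; split; first by apply: minimal_error_upper => // n; rewrite hS -leNgt.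
by move=> p; apply: minimal_error_lower => // n; rewrite hS.
Qed.

End MinimalError.

(** * Counting multi-indices *)

Section BlockIndex.
Variable m : nat -> nat.
Hypothesis m_gt0 : forall i, (0 < m i)%N.

Lemma block_startS k : block_start m k.+1 = (block_start m k + m k)%N.
Proof. by rewrite /block_start big_ord_recr. Qed.

Lemma block_start0 : block_start m 0 = 0%N.
Proof. by rewrite /block_start big_ord0. Qed.

Lemma leq_block_start : {homo block_start m : k l / (k <= l)%N}.
Proof. by apply: homo_leq => // [? ? ? /leq_trans|k];
  [apply|rewrite block_startS leq_addr]. Qed.

Lemma block_start_ge k : (k <= block_start m k)%N.
Proof. by elim: k => // k IH; rewrite block_startS -addn1 leq_add. Qed.

Lemma block_indexP n :
  (block_start m (block_index m n) <= n < block_start m (block_index m n).+1)%N.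
Proof.
rewrite /block_index; case: xgetP => [x -> //|] none.
have ex : exists k, (n < block_start m k)%N by exists n.+1; exact: block_start_ge.
(* The least [k] with [n < r_k] is positive since [r_0 = 0], and its predecessor is the block of
   [n]. *)
case: (ex_minnP ex) => -[|k]; first by rewrite block_start0.
move=> nk kmin; case: (none k) => /=; rewrite nk andbT leqNgt; apply/negP => /kmin.
by rewrite ltnn.
Qed.

Lemma block_index_eq n k :
  (block_start m k <= n < block_start m k.+1)%N -> block_index m n = k.
Proof.
move=> /andP[kn nk]; have /andP[kn' nk'] := block_indexP n.
apply/eqP; rewrite eqn_leq -[(_ <= k)%N]ltnS -[(k <= _)%N]ltnS; apply/andP; split.
  by rewrite ltnNge; apply/negP => /leq_block_start h;
    have := leq_trans nk (leq_trans h kn'); rewrite ltnn.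
by rewrite ltnNge; apply/negP => /leq_block_start h;
  have := leq_trans nk' (leq_trans h kn); rewrite ltnn.
Qed.

Lemma block_index0 : block_index m 0 = 0%N.
Proof. by apply: block_index_eq; rewrite block_startS block_start0 m_gt0. Qed.

Lemma block_index1_le1 : (block_index m 1 <= 1)%N.
Proof.
by have /andP[h _] := block_indexP 1; exact: leq_trans (block_start_ge _) h.
Qed.

Lemma block_index1_eq0 : m 0%N != 1%N -> block_index m 1 = 0%N.
Proof.
move=> m0; apply: block_index_eq; rewrite block_startS block_start0 /= add0n.
by rewrite ltn_neqAle eq_sym m0 m_gt0.
Qed.

Lemma block_index_gt0 n : m 0%N = 1%N -> (0 < n)%N -> (0 < block_index m n)%N.
Proof.
move=> m0 n0; rewrite lt0n; apply/eqP => k0; have := block_indexP n.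
by rewrite k0 block_startS block_start0 add0n m0 ltnS leqn0 eqn0Ngt n0.
Qed.

Lemma ltn_block_index (B n : nat) : (forall i, (m i <= B)%N) ->
  (n < B * (block_index m n).+1)%N.
Proof.
move=> mB; have /andP[_ /leq_trans] := block_indexP n; apply.
elim: (block_index m n).+1 => [|k IH]; first by rewrite block_start0.
by rewrite block_startS mulnS addnC leq_add.
Qed.

End BlockIndex.

(** * Level sets of the weight exponent *)

Section LevelSets.
Variables (R : realType) (m : nat -> nat) (B : nat) (a b : nat -> R) (beta : R).
Hypothesis m_gt0 : forall i, (0 < m i)%N.
Hypothesis mB : forall i, (m i <= B)%N.
Hypothesis a_gt0 : forall j, (1 <= j)%N -> 0 < a j.
Hypothesis a_mono : forall j, (1 <= j)%N -> a j <= a j.+1.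
Hypothesis beta0 : 0 < beta.
Hypothesis b_ge : forall j, (1 <= j)%N -> beta <= b j.

Lemma weight_sequence_homo i j : (1 <= i)%N -> (i <= j)%N -> a i <= a j.
Proof.
move=> i1; elim: j => [|j IH]; first by rewrite leqn0 => /eqP ->.
rewrite leq_eqVlt => /predU1P[->//|ij].
by apply: le_trans (IH ij) (a_mono _); exact: leq_trans i1 ij.
Qed.

Lemma weight_term_ge0 j n : 0 <= a j.+1 * (block_index m n)%:R `^ b j.+1.
Proof. by rewrite mulr_ge0 ?powR_ge0 // ltW // a_gt0. Qed.

(** A single coordinate in block [k >= 1] contributes at least [a_1 k^beta], so a large index alone
    pushes the weight to [T], whatever [s] is. *)
Lemma weight_exponent_bound (T : R) : exists M : nat,
  forall s (n : {ffun 'I_s -> nat}), weight_exponent m a b n < T ->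
  forall j, (n j < M)%N.
Proof.
(* [y] solves [a_1 y^beta = |T|]; the successor gives [K >= 1], so that passing from exponent [beta]
   to [b j] does not decrease the power. *)
pose y := (`|T| / a 1) `^ beta^-1; pose K := (Num.bound y).+1.
have a1 : 0 < a 1 by exact: a_gt0.
have yK : y <= K%:R.
  by apply: ltW; apply: lt_le_trans (archi_boundP (powR_ge0 _ _)) _;
    rewrite ler_nat.
exists (B * K.+1)%N => s n + j; apply: contraTT; rewrite -leqNgt -leNgt => Mn.
apply: le_trans (ler_norm T) _; rewrite /weight_exponent (bigD1 j) //=.
apply: ler_wpDr; first by apply: sumr_ge0 => i _; exact: weight_term_ge0.
have Kn : (K <= block_index m (n j))%N.
  rewrite -ltnS -(@ltn_pmul2l B); last first.
    by rewrite (leq_trans (m_gt0 0)).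
  have := ltn_block_index m_gt0 (n j) mB; apply: leq_ltn_trans.
  by apply: leq_trans Mn; rewrite leq_pmul2l // (leq_trans (m_gt0 0)).
have Kn' : 1 <= (block_index m (n j))%:R :> R.
  by rewrite -[1]/(1%:R) ler_nat; apply: leq_trans Kn.
apply: (@le_trans _ _ (a 1 * (block_index m (n j))%:R `^ beta)); last first.
  apply: ler_pM; rewrite ?powR_ge0 ?(ltW a1) ?weight_sequence_homo //.
  by apply: ler_powR => //; exact: b_ge.
rewrite mulrC -ler_pdivrMr //.
have -> : `|T| / a 1 = y `^ beta.
  by rewrite /y -powRrM mulVf ?gt_eqF // powRr1 // divr_ge0 // ltW.
apply: ge0_ler_powR; rewrite ?nnegrE ?powR_ge0 ?ler0n ?(ltW beta0) //.
by apply: le_trans yK _; rewrite ler_nat.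
Qed.

Definition embed s M (f : {ffun 'I_s -> 'I_M}) : {ffun 'I_s -> nat} :=
  [ffun j => f j : nat].

Lemma embed_inj s M : injective (@embed s M).
Proof.
move=> f g /ffunP fg; apply/ffunP => j; apply: val_inj.
by have := fg j; rewrite !ffunE.
Qed.

(** The level set is cut to the box below [M] in order to enumerate a finite type; it is complete
    once [M] bounds its coordinates. *)
Definition level s (T : R) M : seq {ffun 'I_s -> nat} :=
  [seq @embed s M f | f <- enum {ffun 'I_s -> 'I_M} & weight_exponent m a b (embed
    f) < T].

Lemma level_uniq s T M : uniq (level s T M).
Proof. rewrite map_inj_uniq; [|exact: embed_inj].
by apply: filter_uniq; exact: enum_uniq. Qed.

Lemma mem_level s T M (n : {ffun 'I_s -> nat}) :
  (weight_exponent m a b n < T -> forall j, (n j < M)%N) ->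
  (n \in level s T M) = (weight_exponent m a b n < T).
Proof.
move=> nM; apply/mapP/idP => [[f + ->]|nT]; first by rewrite mem_filter => /andP[].
have nE : n = embed [ffun j => Ordinal (nM nT j)] by apply/ffunP => j;
  rewrite !ffunE.
by exists [ffun j => Ordinal (nM nT j)] => //; rewrite mem_filter mem_enum -nE nT.
Qed.

(* Chernoff bound: [1_{W < T} <= exp(x (T - W))], and the exponential of the
   additive weight [W] factorizes over the coordinates. *)
Lemma size_level_le s T M (x : R) : 0 <= x ->
  (size (level s T M))%:R <= expR (x * T) *
    \prod_(j < s) \sum_(i < M) expR (- (x * (a j.+1 * (block_index m i)%:R `^ b
      j.+1))).
Proof.
move=> x0; rewrite bigA_distr_bigA /= mulr_sumr size_map size_filter -sum1_count.
rewrite big_enum_cond /= natr_sum big_mkcond /=; apply: ler_sum => f _.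
case: ifP => [fT|_]; last by rewrite mulr_ge0 ?expR_ge0 ?prodr_ge0 // => j _;
  exact: expR_ge0.
rewrite -expR_sum -expRD -[leLHS]expR0 ler_expR sumrN -mulr_sumr subr_ge0.
apply: ler_wpM2l => //; apply: le_trans (ltW fT).
by apply: ler_sum => j _; rewrite ffunE.
Qed.

Lemma size_level_ge s T M : (1 < M)%N ->
  (forall f : {ffun 'I_s -> 'I_2}, weight_exponent m a b (embed f) < T) ->
  (2 ^ s <= size (level s T M))%N.
Proof.
move=> M2 hT; rewrite -[X in (X ^ _)%N]card_ord -[X in (_ ^ X)%N](card_ord s)
  -card_ffun.
rewrite cardT -(size_map (@embed s 2)); apply: uniq_leq_size.
  by rewrite map_inj_uniq ?enum_uniq //; exact: embed_inj.
move=> _ /mapP[f _ ->]; rewrite mem_level ?hT // => _ j.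
by rewrite ffunE; exact: leq_trans M2.
Qed.

Lemma weight_exponent_embed2_le s (f : {ffun 'I_s -> 'I_2}) : (0 < s)%N ->
  weight_exponent m a b (embed f) <= s%:R * a s.
Proof.
move=> s0; rewrite mulr_natl -[X in _ *+ X](card_ord s) -sumr_const;
  apply: ler_sum => j _.
rewrite ffunE; apply: (@le_trans _ _ (a j.+1)); last exact: weight_sequence_homo.
(* Zero to the power zero is 1 by convention, so block 0 has weight zero only for a nonzero
   exponent. *)
have bj : b j.+1 != 0 by rewrite gt_eqF // (lt_le_trans beta0) // b_ge.
rewrite -[leRHS]mulr1; apply: ler_wpM2l; first by rewrite ltW // a_gt0.
have /orP[/eqP ->|/eqP ->] : (block_index m (f j) == 0)%N || (block_index m (f j)
  == 1)%N.
- have := ltn_ord (f j); case: (nat_of_ord (f j)) => [|[|]] //= _.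
    by rewrite block_index0.
  by have := block_index1_le1 m_gt0; case: (block_index m 1) => [|[]].
- by rewrite powR0.
- by rewrite powR1.
Qed.

Lemma weight_exponent_embed2_eq0 s (f : {ffun 'I_s -> 'I_2}) : m 0%N != 1%N ->
  weight_exponent m a b (embed f) = 0.
Proof.
move=> m0; apply: big1 => j _; rewrite ffunE.
have -> : block_index m (f j) = 0%N.
  have := ltn_ord (f j); case: (nat_of_ord (f j)) => [|[|]] //= _.
    by rewrite block_index0.
  exact: block_index1_eq0.
by rewrite powR0 ?mulr0 // gt_eqF // (lt_le_trans beta0) // b_ge.
Qed.

End LevelSets.

(** * Exponential sums over one coordinate *)

Lemma sum_inv_sqr_le2 (R : realType) n : \sum_(i < n) (i.+1%:R ^+ 2)^-1 <= 2 :> R.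
Proof.
(* Telescoping: [1/(n+1)^2 <= 1/n - 1/(n+1)]. At [n = 0] the inverse of zero is zero, so the step
   from 0 to 1 is done apart. *)
suff h : \sum_(i < n) (i.+1%:R ^+ 2)^-1 <= 2 - n%:R^-1 :> R.
  by apply: le_trans h _; rewrite gerBl invr_ge0.
elim: n => [|n IH]; first by rewrite big_ord0 invr0 subr0.
rewrite big_ord_recr /=; case: n IH => [_|n IH].
  by rewrite big_ord0 add0r expr1n invr1 lerBrDr.
apply: le_trans (lerD IH (lexx _)) _.
have n1 : 0 < n.+1%:R :> R by [].
have n2 : 0 < n.+2%:R :> R by [].
have n12 : n.+2%:R = n.+1%:R + 1 :> R by rewrite -natr1.
rewrite -addrA lerD2l -lerBrDl opprK addrC.
have -> : n.+1%:R^-1 - n.+2%:R^-1 = (n.+1%:R * n.+2%:R)^-1 :> R.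
  by rewrite n12; move: (n.+1%:R) n1 => u u0; field;
    rewrite !gt_eqF // ltr_wpDl // ltW.
by rewrite lef_pV2 ?posrE ?exprn_gt0 ?mulr_gt0 // expr2 ler_pM2r // ler_nat.
Qed.

(** Only the term of degree [q.+1] of the series of [exp z] is kept. *)
Lemma expRN_le_pow (R : realType) (q : nat) (z : R) : 0 < z ->
  expR (- z) <= q.+1`!%:R / z ^+ q.+1.
Proof.
move=> z0; rewrite expRN -[leRHS]invf_div lef_pV2 ?posrE ?expR_gt0 //; last first.
  by rewrite divr_gt0 ?exprn_gt0 // ltr0n fact_gt0.
by apply: le_trans (expR_ge1Dxn q (ltW z0)); rewrite lerDr.
Qed.

Section CoordinateSum.
Variables (R : realType) (m : nat -> nat) (B : nat).
Hypothesis m_gt0 : forall i, (0 < m i)%N.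
Hypothesis mB : forall i, (m i <= B)%N.
Hypothesis m0 : m 0%N = 1%N.

(** Since [m 0 = 1], index 0 alone lies in block 0 and gives the summand 1. Other indices have
    [k >= 1], and [2 <= beta * q.+1] makes the power bound decay at least like [k^-2]. *)
Lemma coordinate_sum_le (q M : nat) (y beta : R) : 0 < y -> 0 < beta ->
  2 <= beta * q.+1%:R ->
  \sum_(i < M) expR (- (y * (block_index m i)%:R `^ beta)) <=
  1 + q.+1`!%:R * (2 * B%:R) ^+ 2 * 2 / y ^+ q.+1.
Proof.
move=> y0 b0 bq; set F := _`!%:R; set D := _ ^+ 2.
have D0 : 0 <= D by exact: sqr_ge0.
have DE : D = (2 * B%:R) ^+ 2 by []; clearbody D.
have F0 : 0 <= F by [].
case: M => [|M].
  by rewrite big_ord0 addr_ge0 // !mulr_ge0 ?invr_ge0 ?exprn_ge0 // ltW.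
rewrite big_ord_recl /= block_index0 // powR0 ?gt_eqF // mulr0 oppr0 expR0 lerD2l.
apply: (@le_trans _ _ (\sum_(i < M) F * D / y ^+ q.+1 * (i.+1%:R ^+ 2)^-1)).
  apply: ler_sum => i _; rewrite /bump /= add1n.
  set K := block_index m i.+1.
  have K0 : (0 < K)%N by exact: block_index_gt0.
  have K1 : 1 <= K%:R :> R by rewrite -[1]/(1%:R) ler_nat.
  (* From [i + 1 < B (k + 1)] and [k + 1 <= 2 k]. *)
  have iK : i.+1%:R <= 2 * B%:R * K%:R :> R.
    rewrite -!natrM ler_nat; apply: ltnW;
      apply: leq_trans (ltn_block_index m_gt0 _ mB) _.
    by rewrite -/K mulnC -mulnA mulnCA mulnC mul2n -addnn leq_mul // -addn1
      leq_add2l.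
  apply: le_trans (expRN_le_pow q _) _;
    first by rewrite mulr_gt0 // powR_gt0 // ltr0n.
  rewrite exprMn -(powR_mulrn q.+1 (powR_ge0 K%:R beta)) -powRrM invfM -!mulrA
    ler_wpM2l //.
  rewrite [leRHS]mulrCA ler_wpM2l ?invr_ge0 ?exprn_ge0 ?(ltW y0) //.
  apply: (@le_trans _ _ ((K%:R ^+ 2)^-1)).
    rewrite lef_pV2 ?posrE ?powR_gt0 ?exprn_gt0 ?ltr0n //.
    by rewrite -powR_mulrn //; apply: ler_powR.
  rewrite ler_pdivlMr ?exprn_gt0 // mulrC ler_pdivrMr ?exprn_gt0 ?ltr0n //.
  by rewrite DE -exprMn ler_pXn2r ?nnegrE ?mulr_ge0 //.
rewrite -mulr_sumr.
apply: (@le_trans _ _ (F * D / y ^+ q.+1 * 2)).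
  apply: ler_wpM2l; last exact: sum_inv_sqr_le2.
  by rewrite !mulr_ge0 ?invr_ge0 ?exprn_ge0 // ltW.
by rewrite le_eqVlt mulrAC eqxx.
Qed.

End CoordinateSum.

(** * Upper and lower bounds for the information complexity *)

Section CountingBounds.
Variables (R : realType) (k : scalar_kind) (H : hilbertSpace R k).
Variables (e : nat -> H) (omega : R) (m : nat -> nat) (B : nat).
Variables (a b : nat -> R) (beta : R) (s : nat) (Hs : hilbertTensorPower H s).
Hypothesis he : orthonormal_basis e.
Hypothesis homega : 0 < omega < 1.
Hypothesis m_gt0 : forall i, (0 < m i)%N.
Hypothesis mB : forall i, (m i <= B)%N.
Hypothesis a_gt0 : forall j, (1 <= j)%N -> 0 < a j.
Hypothesis a_mono : forall j, (1 <= j)%N -> a j <= a j.+1.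
Hypothesis beta0 : 0 < beta.
Hypothesis b_ge : forall j, (1 <= j)%N -> beta <= b j.

Let rate : R := 2 / ln omega^-1.
Let N eps := info_complexity e omega m a b Hs eps.

Lemma rate_gt0 : 0 < rate.
Proof.
have /andP[om0 om1] := homega.
by rewrite divr_gt0 // ln_gt0 // invf_gt1.
Qed.

(** Taking logarithms, [omega^(-W)] is below [eps ^- 2] exactly when [W] is below
    [rate * ln eps^-1]. *)
Lemma info_complexity_level (eps : R) : 0 < eps ->
  exists2 M : nat, (1 < M)%N & N eps = size (level m a b s (rate * ln eps^-1) M).
Proof.
move=> eps0; set T := rate * _.
have [M hM] := weight_exponent_bound m_gt0 mB a_gt0 a_mono beta0 b_ge T.
(* The extra 2 makes the box contain [{0,1}^s], which the lower bound counts. *)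
exists (M + 2)%N; first by rewrite addn2.
have /andP[om0 om1] := homega.
have ln_gt : 0 < ln omega^-1 by rewrite ln_gt0 // invf_gt1.
apply: info_complexityE => //; first exact: level_uniq.
move=> n; rewrite mem_level => [|nT j]; last by apply: ltn_addr; exact: hM.
rewrite -[RHS]ltr_ln ?posrE ?powR_gt0 ?invr_gt0 ?exprn_gt0 // ln_powR mulNr -mulrN
  -lnV //.
rewrite -exprVn lnXn ?invr_gt0 // -ltr_pdivlMr //.
by rewrite /T /rate -(mulr_natl (ln eps^-1)) mulrAC.
Qed.

(* The constant combines [exp(-z) <= q!/z^q], [n < 2 B k(n)] for [n >= 1] and
   [sum_n n^-2 <= 2]. *)
Lemma ln_info_complexity_le (q : nat) (eps x : R) : m 0%N = 1%N ->
  2 <= beta * q.+1%:R -> 0 < eps < 1 -> 0 < x ->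
  ln (N eps)%:R <= x * (rate * ln eps^-1) +
    \sum_(j < s) ln (1 + q.+1`!%:R * (2 * B%:R) ^+ 2 * 2 / (x * a j.+1) ^+ q.+1).
Proof.
move=> m0 bq /andP[eps0 eps1] x0; set C := _ * 2.
have C0 : 0 <= C by rewrite /C !mulr_ge0 ?exprn_ge0 ?mulr_ge0.
have [M _ ->] := info_complexity_level eps0; set T := rate * _.
have T0 : 0 <= T.
  by apply: mulr_ge0; rewrite ltW ?rate_gt0 // ln_gt0 // invf_gt1.
have Cj (j : 'I_s) : 0 <= C / (x * a j.+1) ^+ q.+1.
  by rewrite divr_ge0 // exprn_ge0 // mulr_ge0 ?ltW // a_gt0.
(* An empty level set is treated apart: the logarithm of 0 is 0 by convention. *)
case: (posnP (size (level m a b s T M))) => [->|sz].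
  rewrite ln0 // addr_ge0 ?(mulr_ge0 (ltW x0) T0) ?sumr_ge0 // => j _.
  by rewrite ln_ge0 // lerDl.
rewrite -[leRHS]expRK ler_ln ?posrE ?expR_gt0 ?ltr0n // expRD expR_sum.
apply: le_trans (size_level_le _ _ _ _ _ _ (ltW x0)) _.
rewrite ler_wpM2l ?expR_ge0 //; apply: ler_prod => j _.
rewrite sumr_ge0 /= => [|i _]; last exact: expR_ge0.
rewrite lnK ?posrE; last by rewrite ltr_wpDr.
under eq_bigr => i _ do rewrite mulrA.
apply: coordinate_sum_le => //; first by rewrite mulr_gt0 // a_gt0.
  by rewrite (lt_le_trans beta0) // b_ge.
by apply: le_trans bq _; rewrite ler_wpM2r // b_ge.
Qed.

(** Both alternatives place [{0,1}^s] in the level set: for [m 0 >= 2] the weight vanishes there and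
    the threshold is positive; in the other case the weight is at most [s a_s]. *)
Lemma info_complexity_ge (eps : R) : (0 < s)%N -> 0 < eps < 1 ->
  m 0%N != 1%N \/ s%:R * a s < rate * ln eps^-1 ->
  s%:R * ln 2 <= ln (N eps)%:R :> R.
Proof.
move=> s0 /andP[eps0 eps1] hs; have [M M2 ->] := info_complexity_level eps0.
set T := rate * _.
have T0 : 0 < T.
  by apply: mulr_gt0; rewrite ?rate_gt0 // ln_gt0 // invf_gt1.
have : (2 ^ s <= size (level m a b s T M))%N.
  apply: size_level_ge => // f.
  case: hs => [m0|]; first by rewrite (weight_exponent_embed2_eq0 _ m_gt0 beta0
    b_ge).
  apply: le_lt_trans; exact: (weight_exponent_embed2_le m_gt0 a_gt0 a_mono beta0
    b_ge).
rewrite -(ler_nat R) => h; have p2 : 0 < (2 ^ s)%:R :> R by rewrite ltr0n expn_gt0.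
apply: (@le_trans _ _ (ln (2 ^ s)%:R));
  last by rewrite ler_ln ?posrE // (lt_le_trans p2).
by rewrite natrX lnXn // mulr_natl.
Qed.

End CountingBounds.

(** * Asymptotics *)

Section Asymptotics.
Variables (R : realType) (N : nat -> R -> nat) (a : nat -> R) (c : R).
Hypothesis c0 : 0 < c.

Lemma ln_nat_ge0 n : 0 <= ln n%:R :> R.
Proof. by case: n => [|n]; [rewrite ln0|rewrite ln_ge0 // -[1]/(1%:R) ler_nat]. Qed.

Lemma not_near_infty (P : nat -> Prop) : ~ (\forall j \near \oo, P j) ->
  forall J, exists2 j, (J <= j)%N & ~ P j.
Proof.
move=> nP J; apply: contrapT => h; apply: nP; exists J => // j /= Jj.
by apply: contrapT => nPj; apply: h; exists j.
Qed.

(** Separates the early terms, where [v] need not dominate; they are added in full so that the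
    correction is independent of [s]. *)
Lemma sum_ord_le_tail (u v : nat -> R) (J s : nat) :
  (forall j, 0 <= u j) -> (forall j, 0 <= v j) ->
  (forall j, (J <= j)%N -> u j <= v j) ->
  \sum_(j < s) u j <= \sum_(j < s) v j + \sum_(j < J) u j.
Proof.
move=> u0 v0 uv; elim: s => [|s IH].
  by rewrite !big_ord0 add0r sumr_ge0.
have [Js|sJ] := leqP J s.
  by rewrite !big_ord_recr /= addrAC lerD // uv.
apply: (@le_trans _ _ (\sum_(j < J) u j)); last by rewrite lerDr sumr_ge0.
rewrite -!(big_mkord xpredT) (@big_cat_nat _ _ _ s.+1 0 J) //= lerDl.
by rewrite sumr_ge0.
Qed.

(** With [eps = exp(-L)] the quotient and the absolute value disappear, as [ln N >= 0] and the
    denominator is positive. *)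
Lemma EC_ttWT_intro (t1 t2 : R) :
  (forall delta : R, 0 < delta -> exists M : R, forall s L, (0 < s)%N -> 0 < L ->
    M < s%:R + expR L ->
    ln (N s (expR (- L)))%:R < delta * (s%:R `^ t1 + L `^ t2)) ->
  EC_ttWT N t1 t2.
Proof.
move=> h delta /h[M hM]; exists M => s eps s0 /andP[eps0 eps1].
have epsE : eps = expR (- ln eps^-1) by rewrite lnV ?posrE // opprK lnK.
have -> : eps^-1 = expR (ln eps^-1) by rewrite lnK // posrE invr_gt0.
move/hM => /(_ s0); rewrite ln_gt0 ?invf_gt1 // expRK -epsE => /(_ isT) le.
have D0 : 0 < s%:R `^ t1 + ln eps^-1 `^ t2.
  by rewrite ltr_wpDr ?powR_ge0 // powR_gt0 // ltr0n.
by rewrite ger0_norm ?ltr_pdivrMr // divr_ge0 ?ln_nat_ge0 // ltW.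
Qed.

(** Along the given pairs the ratio stays at least [ln 2 / K], while [s] exceeds every bound. *)
Lemma not_EC_ttWT (t1 t2 K : R) : 0 < K ->
  (forall J, exists s L, [/\ (J <= s)%N, (0 < s)%N, 0 < L,
     s%:R * ln 2 <= ln (N s (expR (- L)))%:R :> R &
     s%:R `^ t1 + L `^ t2 <= K * s%:R]) ->
  ~ EC_ttWT N t1 t2.
Proof.
move=> K0 h wt; have l2 : 0 < ln 2 :> R by rewrite ln_gt0 // -[1]/(1%:R) ltr_nat.
have [M hM] := wt (ln 2 / K) (divr_gt0 l2 K0).
have [s [L [Ms s0 L0 ge le]]] := h (Num.bound `|M|).
have s0' : 0 < s%:R :> R by rewrite ltr0n.
have : M < s%:R + (expR (- L))^-1.
  rewrite ltr_wpDr ?invr_ge0 ?expR_ge0 //; apply: le_lt_trans (ler_norm M) _.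
  by apply: lt_le_trans (archi_boundP (normr_ge0 _)) _; rewrite ler_nat.
move/(hM s (expR (- L)) s0); rewrite expR_gt0 expR_lt1 oppr_lt0 L0 => /(_ isT).
rewrite -expRN opprK expRK ltNge => /negP; apply.
have D0 : 0 < s%:R `^ t1 + L `^ t2 by rewrite ltr_wpDr ?powR_ge0 // powR_gt0.
apply: le_trans (ler_norm _); rewrite ler_pdivlMr //.
apply: le_trans ge; rewrite mulrAC ler_pdivrMr // [leRHS]mulrAC [leRHS]mulrC.
by rewrite ler_pM2l // [leRHS]mulrC.
Qed.

(** * Sufficiency of the growth conditions *)

Section Sufficiency.
Variables (C : R) (q : nat).
Hypothesis C0 : 0 <= C.
Hypothesis a_gt0 : forall j, (1 <= j)%N -> 0 < a j.
Hypothesis lnN : forall (s : nat) (eps x : R), 0 < eps < 1 -> 0 < x ->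
  ln (N s eps)%:R <= x * (c * ln eps^-1) +
    \sum_(j < s) ln (1 + C / (x * a j.+1) ^+ q.+1).

Lemma lnN_expR s L x : 0 < L -> 0 < x ->
  ln (N s (expR (- L)))%:R <=
    x * (c * L) + \sum_(j < s) ln (1 + C / (x * a j.+1) ^+ q.+1).
Proof.
move=> L0 x0; have := lnN s (eps := expR (- L)) _ x0.
by rewrite expR_gt0 expR_lt1 oppr_lt0 L0 -expRN opprK expRK; apply.
Qed.

Lemma EC_WT_suff : a j @[j --> \oo] --> +oo -> EC_WT N.
Proof.
move=> /cvgryPge a_oo; apply: EC_ttWT_intro => delta d0.
(* This [x] turns the first term of [lnN] into [delta / 3 * L]. *)
pose x := delta / 3 / c; have x0 : 0 < x by rewrite !divr_gt0.
pose u j := C / (x * a j.+1) ^+ q.+1.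
have xa j : 0 < x * a j.+1 by rewrite mulr_gt0 // a_gt0.
have u0 j : 0 <= u j by rewrite divr_ge0 // exprn_ge0 // ltW.
(* The maximum with 1 ensures [(x a_j)^(q+1) >= x a_j] in the tail, so each tail term is at most
   [delta / 3]. *)
pose y := Num.max 1 (C / (delta / 3)).
have y1 : 1 <= y by rewrite le_max lexx.
have y0 : 0 < y by exact: lt_le_trans y1.
have [J _ hJ] := a_oo (y / x).
have uJ j : (J <= j)%N -> u j <= delta / 3.
  move=> Jj; have ya : y <= x * a j.+1.
    by rewrite mulrC -ler_pdivrMr //; apply: hJ; exact: leqW.
  rewrite /u ler_pdivrMr ?exprn_gt0 // mulrC -ler_pdivrMr ?divr_gt0 //.
  apply: (@le_trans _ _ y); first by rewrite le_max lexx orbT.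
  by apply: (le_trans ya); apply: ler_eXnr => //; exact: le_trans ya.
pose U := \sum_(j < J) u j; have U0 : 0 <= U by exact: sumr_ge0.
(* Past this threshold [s] or [L] exceeds [2 U / delta], so [U] is below half of [delta (s + L)];
   the remaining terms make up a third of it. *)
exists (2 * U / delta + expR (2 * U / delta)) => s L s0 L0 MsL.
have sL : 2 * U / delta < s%:R + L.
  rewrite ltNge; apply: contraTN MsL => sL; rewrite -leNgt lerD //.
    by apply: le_trans sL; rewrite lerDl ltW.
  by rewrite ler_expR; apply: le_trans sL; rewrite lerDr.
rewrite !powRr1 ?(ltW L0) //.
apply: le_lt_trans (lnN_expR s L0 x0) _.
apply: (@le_lt_trans _ _ (delta / 3 * L + (s%:R * (delta / 3) + U))); last first.
  by move: sL; rewrite ltr_pdivrMr //; nra.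
rewrite lerD //; first by rewrite /x mulrA divfK // gt_eqF.
apply: (@le_trans _ _ (\sum_(j < s) u j)).
  by apply: ler_sum => j _; apply: le_ln1Dx; exact: lt_le_trans (u0 j).
have d3 : 0 <= delta / 3 by rewrite divr_ge0 // ltW.
have := @sum_ord_le_tail u (fun=> delta / 3) J s u0 (fun=> d3) uJ.
by rewrite sumr_const card_ord -(mulr_natl (delta / 3)).
Qed.

(** By induction [1 + v^(p+1) <= (1 + v)^(p+1)], and the exponent leaves the logarithm as a
    factor. *)
Lemma ln1D_pow_le (p : nat) (v : R) : 0 <= v -> ln (1 + v ^+ p.+1) <= p.+1%:R * v.
Proof.
move=> v0; apply: (@le_trans _ _ (ln ((1 + v) ^+ p.+1))).
  rewrite ler_ln ?posrE ?exprn_gt0 ?ltr_wpDr ?exprn_ge0 //.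
  elim: p => [|p IH]; first by rewrite !expr1.
  rewrite [leRHS]exprS mulrDl mul1r [v ^+ _]exprS.
  apply: (@le_trans _ _ (1 + v ^+ p.+1 + v * (1 + v ^+ p.+1))).
    by rewrite mulrDr mulr1 -!addrA lerD2l !addrA lerDr addr_ge0 ?exprn_ge0.
  by rewrite lerD // ler_wpM2l.
have v1 : 0 < 1 + v by rewrite ltr_wpDr.
rewrite lnXn // -[_ *+ _]mulr_natl. apply: ler_wpM2l => //; apply: le_ln1Dx.
exact: lt_le_trans v0.
Qed.

Lemma EC_UWT_suff : ln (a j) / ln j%:R @[j --> \oo] --> +oo -> EC_UWT N.
Proof.
move=> /cvgryPge a_oo t1 t2 /andP[t10 _] /andP[t20 _].
apply: EC_ttWT_intro => delta d0.
(* Large enough for [theta = (q+1)/(p+1)] to satisfy [2 theta <= t2]. *)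
pose p := Num.bound (2 * q.+1%:R / t2).
have q0 : 0 < q.+1%:R :> R by [].
have tq0 : 0 < 2 * q.+1%:R / t2 by rewrite divr_gt0 // mulr_gt0.
have p_gt : 2 * q.+1%:R / t2 < p.+1%:R.
  by apply: lt_le_trans (archi_boundP (ltW tq0)) _; rewrite ler_nat.
have p0 : 0 < p.+1%:R :> R by [].
pose theta : R := q.+1%:R / p.+1%:R.
have th0 : 0 < theta by rewrite divr_gt0.
have th2 : theta * 2 <= t2.
  rewrite /theta mulrAC ler_pdivrMr // mulrC [t2 * _]mulrC -ler_pdivrMr //.
  exact: ltW.
pose w j := a j.+1 `^ (- theta).
have w0 j : 0 <= w j by exact: powR_ge0.
(* From [J] on, [ln a_j / ln j >= 2 / theta], which for [j >= 2] means [a_j^(-theta) <= j^-2]. *)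
have [J _ hJ] := a_oo (2 / theta).
have wJ j : (J.+1 <= j)%N -> w j <= (j.+1%:R ^+ 2)^-1.
  move=> Jj; have := hJ j.+1 (leqW (ltnW Jj)); have j1 : 1 < j.+1%:R :> R.
    by rewrite -[1]/(1%:R) ltr_nat ltnS (leq_ltn_trans _ Jj).
  have lj : 0 < ln j.+1%:R :> R by rewrite ln_gt0.
  rewrite /= ler_pdivlMr // mulrAC ler_pdivrMr // => h.
  have aj : 0 < a j.+1 by exact: a_gt0.
  rewrite /w powRN lef_pV2 ?posrE ?powR_gt0 ?exprn_gt0 //.
  rewrite -ler_ln ?posrE ?powR_gt0 ?exprn_gt0 // ln_powR lnXn //.
  by rewrite -(mulr_natl (ln _)) [leRHS]mulrC.
pose A := 2 + \sum_(j < J.+1) w j.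
have sum_w s : \sum_(j < s) w j <= A.
  apply: le_trans (sum_ord_le_tail s w0 _ wJ) _.
    by move=> j; rewrite invr_ge0 sqr_ge0.
  by rewrite lerD2r sum_inv_sqr_le2.
have A0 : 0 <= A by rewrite addr_ge0 ?sumr_ge0.
pose D := C `^ p.+1%:R^-1.
have D0 : 0 <= D by exact: powR_ge0.
pose G := p.+1%:R * D * A.
have G0 : 0 <= G by rewrite !mulr_ge0.
(* The choice [x = 1 / L] makes the first term of [lnN] the constant [c], and each summand
   [ln (1 + v^(p+1))] with [v = D L^theta a_j^(-theta)]. *)
have le s L : 0 < L -> ln (N s (expR (- L)))%:R <= c + G * L `^ theta.
  move=> L0; have Li : 0 < L^-1 by rewrite invr_gt0.
  apply: le_trans (lnN_expR s L0 Li) _.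
  rewrite mulrCA mulVf ?gt_eqF // mulr1 lerD2l.
  apply: (@le_trans _ _ (\sum_(j < s) p.+1%:R * (D * L `^ theta * w j))).
    apply: ler_sum => j _; have aj : 0 < a j.+1 by exact: a_gt0.
    have -> : C / (L^-1 * a j.+1) ^+ q.+1 = (D * L `^ theta * w j) ^+ p.+1.
      have pw (y z : R) : (y `^ z) ^+ p.+1 = y `^ (z * p.+1%:R).
        by rewrite -powR_mulrn ?powR_ge0 // -powRrM.
      rewrite /D /w !exprMn !pw mulVf ?gt_eqF // powRr1 // mulNr /theta divfK
        ?gt_eqF //.
      by rewrite powRN !powR_mulrn ?(ltW L0) ?(ltW aj) // invfM exprVn invrK mulrA.
    by apply: ln1D_pow_le; rewrite !mulr_ge0 // powR_ge0.
  rewrite -mulr_sumr -mulr_sumr /G -!mulrA ler_wpM2l // ler_wpM2l //.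
  by rewrite [A * _]mulrC ler_wpM2l // powR_ge0.
(* For [L > L0] one has [c + G < delta L^theta], so the bound is below [delta L^(2 theta)], hence
   below [delta L^t2]. *)
pose L0 := 1 + ((c + G) / delta) `^ theta^-1.
pose U := c + G * L0 `^ theta.
have L0_0 : 0 <= L0 by rewrite addr_ge0 // powR_ge0.
have U0 : 0 <= U by rewrite addr_ge0 ?mulr_ge0 ?powR_ge0 // ltW.
(* If [L <= L0], the bound is at most the constant [U], and passing this threshold forces
   [s^t1 > U / delta]. *)
exists ((U / delta) `^ t1^-1 + expR L0) => s L s0 Lgt MsL.
apply: le_lt_trans (le s L Lgt) _.
have [LL0|L0L] := leP L L0.
  have hs : (U / delta) `^ t1^-1 < s%:R.
    by move: MsL; rewrite -ltrBlDr; apply: le_lt_trans;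
      rewrite -addrA lerDl subr_ge0 ler_expR.
  apply: (@le_lt_trans _ _ U).
    rewrite lerD2l ler_wpM2l //; apply: ge0_ler_powR; rewrite ?nnegrE ?(ltW th0) //.
    exact: ltW.
  rewrite mulrC -ltr_pdivrMr //; apply: ltr_wpDr; first exact: powR_ge0.
  have -> : U / delta = ((U / delta) `^ t1^-1) `^ t1.
    by rewrite -powRrM mulVf ?gt_eqF // powRr1 // divr_ge0 // ltW.
  by apply: gt0_ltr_powR; rewrite ?nnegrE ?powR_ge0.
have L1 : 1 <= L by apply: le_trans (ltW L0L); rewrite lerDl powR_ge0.
have Lth1 : 1 <= L `^ theta by rewrite -(powRr0 L); apply: ler_powR => //;
  exact: ltW.
have Lth : (c + G) / delta < L `^ theta.
  have -> : (c + G) / delta = (((c + G) / delta) `^ theta^-1) `^ theta.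
    by rewrite -powRrM mulVf ?gt_eqF // powRr1 // divr_ge0 ?(ltW d0) // addr_ge0
      // ltW.
  apply: gt0_ltr_powR; rewrite ?nnegrE ?powR_ge0 ?(ltW Lgt) //.
  by apply: le_lt_trans L0L; rewrite lerDr.
have Lt2 : L `^ theta ^+ 2 <= L `^ t2.
  by rewrite -powR_mulrn ?powR_ge0 // -powRrM; apply: ler_powR.
have st : 0 <= s%:R `^ t1 by exact: powR_ge0.
move: Lth; rewrite ltr_pdivrMr // => Lth.
apply: (@lt_le_trans _ _ (delta * L `^ theta ^+ 2)).
  apply: (@le_lt_trans _ _ ((c + G) * L `^ theta)).
    by rewrite mulrDl lerD2r ler_peMr // ltW.
  by rewrite expr2 mulrA ltr_pM2r ?powR_gt0 // mulrC.
by rewrite ler_wpM2l ?(ltW d0) //; apply: le_trans Lt2 _; rewrite lerDr.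
Qed.

End Sufficiency.

(** * Necessity of the growth conditions *)

Section Necessity.
Hypothesis lnN_ge : forall s L, (0 < s)%N -> 0 < L -> s%:R * a s < c * L ->
  s%:R * ln 2 <= ln (N s (expR (- L)))%:R :> R.

(** If [a_s < A] for arbitrarily large [s], then [L = s K / c] with [K = |A| + 1] gives
    [s a_s < c L]; the denominator [s + L] is a multiple of [s], so the ratio does not tend to 0. *)
Lemma EC_WT_nec : EC_WT N -> a j @[j --> \oo] --> +oo.
Proof.
move=> wt; apply/cvgryPge => A; apply: contrapT => /not_near_infty aA.
pose K := `|A| + 1; have K0 : 0 < K by rewrite ltr_wpDl.
have Kc : 0 < K / c by rewrite divr_gt0.
apply: (@not_EC_ttWT 1 1 (1 + K / c)) wt; first by rewrite addr_gt0.
move=> J; have [s Js /negP] := aA (maxn 1 J); rewrite -ltNge => asA.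
have s0 : (0 < s)%N by apply: leq_trans Js; rewrite leq_max.
have s0' : 0 < s%:R :> R by rewrite ltr0n.
exists s, (s%:R * (K / c)); split => //.
- by apply: leq_trans Js; rewrite leq_max leqnn orbT.
- exact: mulr_gt0.
- apply: lnN_ge => //; first exact: mulr_gt0.
  rewrite [ltRHS]mulrC mulrA divfK ?gt_eqF // ltr_pM2l //.
  by apply: lt_le_trans asA _; rewrite /K; apply: le_trans (ler_norm _) _;
    rewrite lerDl.
- rewrite (powRr1 (mulr_ge0 (ltW s0') (ltW Kc))) powRr1 //.
  by rewrite [leRHS]mulrDl mul1r [s%:R * _]mulrC.
Qed.

(** Otherwise [a_s <= s^P] for arbitrarily large [s], with [P = |A|]. Then [L = (2 / c) s^(P+1)]
    gives [s a_s < c L], and [t2 = 1/(P+1)] brings [L^t2] back to a multiple of [s]. *)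
Lemma EC_UWT_nec : (forall j, (1 <= j)%N -> 0 < a j) ->
  EC_UWT N -> ln (a j) / ln j%:R @[j --> \oo] --> +oo.
Proof.
move=> a_gt0 uwt; apply/cvgryPge => A; apply: contrapT => /not_near_infty aA.
pose P := `|A|; have P0 : 0 <= P by exact: normr_ge0.
have P1 : 0 < P + 1 by rewrite ltr_wpDl.
have c2 : 0 < 2 / c by rewrite divr_gt0.
have t2 : 0 < (P + 1)^-1 <= 1 by rewrite invr_gt0 P1 invf_le1 // lerDr.
have := uwt 1 _ _ t2; rewrite ltr01 lexx => /(_ isT).
apply: (@not_EC_ttWT 1 (P + 1)^-1 (1 + (2 / c) `^ (P + 1)^-1)).
  by rewrite ltr_wpDr // powR_ge0.
move=> J; have [s Js /negP] := aA (maxn 2 J); rewrite -ltNge => asA.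
have s2 : (2 <= s)%N by apply: leq_trans Js; rewrite leq_max.
have s0 : (0 < s)%N by exact: ltnW.
have s0' : 0 < s%:R :> R by rewrite ltr0n.
have s1' : 1 < s%:R :> R by rewrite -[1]/(1%:R) ltr_nat.
have as_le : a s <= s%:R `^ P.
  rewrite -ler_ln ?posrE ?powR_gt0 ?a_gt0 // ln_powR -ler_pdivrMr ?ln_gt0 //.
  by apply: le_trans (ltW asA) _; exact: ler_norm.
have L0 : 0 < 2 / c * s%:R `^ (P + 1) by rewrite mulr_gt0 // powR_gt0.
exists s, (2 / c * s%:R `^ (P + 1)); split => //.
- by apply: leq_trans Js; rewrite leq_max leqnn orbT.
- apply: lnN_ge => //; rewrite mulrA [c * _]mulrC divfK ?gt_eqF //.
  rewrite powRD ?gt_eqF ?s0' ?implybT // powRr1 //.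
  apply: (@le_lt_trans _ _ (s%:R `^ P * s%:R)); first by rewrite mulrC ler_pM2r.
  by rewrite ltr_pMl ?mulr_gt0 ?powR_gt0 // -[1]/(1%:R) ltr_nat.
- rewrite powRr1 // powRM ?(ltW c2) ?powR_ge0 // -powRrM mulfV ?gt_eqF //.
  by rewrite powRr1 // [leRHS]mulrDl mul1r.
Qed.

End Necessity.

(** Keeping [eps = exp(-1)] fixed, exponential growth in [s] alone rules out EC-WT. *)
Lemma EC_WT_head : (forall s L, (0 < s)%N -> 0 < L ->
    s%:R * ln 2 <= ln (N s (expR (- L)))%:R :> R) -> ~ EC_WT N.
Proof.
move=> h; apply: (@not_EC_ttWT 1 1 2) => // J.
exists J.+1, 1; split => //; first exact: h.
by rewrite !powRr1 // mulr_natl mulr2n lerD2l -[1]/(1%:R) ler_nat.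
Qed.

End Asymptotics.

Theorem theorem7 (R : realType) (k : scalar_kind) (H : hilbertSpace R k)
    (e : nat -> H) (he : orthonormal_basis e)
    (omega : R) (homega : 0 < omega < 1)
    (m : nat -> nat) (m_gt0 : forall i, (0 < m i)%N)
    (m_bounded : exists B : nat, forall i, (m i <= B)%N)
    (a b : nat -> R)
    (a_gt0 : forall j : nat, (1 <= j)%N -> 0 < a j)
    (a_mono : forall j : nat, (1 <= j)%N -> a j <= a j.+1)
    (b_gt0 : forall j : nat, (1 <= j)%N -> 0 < b j)
    (b_inf : 0 < inf [set b j | j in [set j : nat | (1 <= j)%N]])
    (Hs : forall s : nat, hilbertTensorPower H s) :
  let N := fun (s : nat) (eps : R) =>
    info_complexity e omega m a b (Hs s) eps in
  (EC_WT N <-> m 0%N = 1%N /\ a j @[j --> \oo] --> +oo) /\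
  (EC_UWT N <-> m 0%N = 1%N /\ ln (a j) / ln (j%:R) @[j --> \oo] --> +oo).
Proof.
move=> N; have [B mB] := m_bounded.
set beta := inf _ in b_inf.
have b_ge j : (1 <= j)%N -> beta <= b j.
  move=> j1; apply: ge_inf; last by exists j.
  by exists 0 => _ [i /= i1 <-]; rewrite ltW // b_gt0.
(* The exponent is chosen from the infimum of the [b_j], so that one power bound is summable for all
   coordinates. *)
pose q := Num.bound (2 / beta).
have bq : 2 <= beta * q.+1%:R.
  rewrite mulrC -ler_pdivrMr //; apply: ltW.
  have /archi_boundP h : 0 <= 2 / beta by rewrite divr_ge0 // ltW.
  by apply: lt_le_trans h _; rewrite ler_nat.
have c0 : 0 < 2 / ln omega^-1 :> R by exact: rate_gt0.
have upper : m 0%N = 1%N -> forall (s : nat) (eps x : R), 0 < eps < 1 -> 0 < x ->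
    ln (N s eps)%:R <= x * (2 / ln omega^-1 * ln eps^-1) +
      \sum_(j < s) ln (1 + q.+1`!%:R * (2 * B%:R) ^+ 2 * 2 / (x * a j.+1) ^+ q.+1).
  by move=> m0 s eps x; exact: ln_info_complexity_le b_ge _ _ _ m0 bq.
have C0 : 0 <= q.+1`!%:R * (2 * B%:R) ^+ 2 * 2 :> R.
  by rewrite !mulr_ge0 ?exprn_ge0 ?mulr_ge0.
have lower s L : (0 < s)%N -> 0 < L ->
    m 0%N != 1%N \/ s%:R * a s < 2 / ln omega^-1 * L ->
    s%:R * ln 2 <= ln (N s (expR (- L)))%:R :> R.
  move=> s0 L0 h; apply: (info_complexity_ge _ _ _ m_gt0 mB a_gt0 a_mono b_inf
    b_ge) => //.
    by rewrite expR_gt0 expR_lt1 oppr_lt0.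
  by rewrite -expRN opprK expRK.
have lower_a s L : (0 < s)%N -> 0 < L -> s%:R * a s < 2 / ln omega^-1 * L ->
    s%:R * ln 2 <= ln (N s (expR (- L)))%:R :> R.
  by move=> s0 L0 h; apply: lower => //; right.
have head : EC_WT N -> m 0%N = 1%N.
  move=> wt; apply/eqP/negPn/negP => m0; apply: EC_WT_head wt => s L s0 L0.
  by apply: lower => //; left.
split; split.
- by move=> wt; split; [exact: head|exact: EC_WT_nec lower_a wt].
- by move=> [m0]; exact: (EC_WT_suff c0 C0 a_gt0 (upper m0)).
- move=> uwt; split; last exact: EC_UWT_nec lower_a a_gt0 uwt.
  (* EC-UWT at [t1 = t2 = 1] is EC-WT. *)
  by apply: head; apply: uwt; rewrite ltr01 lexx.
- by move=> [m0]; exact: (EC_UWT_suff c0 C0 a_gt0 (upper m0)).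
Qed.
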